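(* Let $\Gamma_{\mathcal T}$ be the group associated with an $\widetilde{A_n}$-triangle presentation $\mathcal T$ over a finite projective geometry $\Pi$ of dimension $n\ge2$. Let $u=u_1\cdots u_\ell\in L$, let $x\in\Pi$, and let $v=v_1\cdots v_k\in L$ be the normal form of $a_{u_1}\cdots a_{u_\ell}a_x$. Then for each integer $t\ge0$ we have $d(u(t),v(t))\le1$; that is, either $u(t)=v(t)$, or $u(t)=v(t)\,a_{x_t}$ for some $x_t\in\Pi$. Thus $\Gamma_{\mathcal T}$ is an automatic group.
   Context: Projective geometry: $\Pi$ denotes the set of all nonempty proper subspaces of a projective space $\mathbf V$ of projective dimension $n\ge 2$ (lines having at least three points), partially ordered by inclusion; $\dim(x)\in\{1,\ldots,n\}$ is the projective dimension of $x$ plus one, and $\Pi_i=\{x\in\Pi:\dim(x)=i\}$. The model case is the set of nontrivial proper subspaces of an $(n+1)$-dimensional vector space $\mathbf V$, with $\dim$ the vector space dimension. Two elements $x,y\in \Pi$ are incident if $x\subset y$ or $y\subset x$ (inclusions not necessarily strict). $x+y$ denotes the join of $x$ and $y$; $x+y=\mathbf V$ means that no $z\in\Pi$ contains both $x$ and $y$. Here $\Pi$ is assumed finite. Triangle presentation: let $\lambda:\Pi\to\Pi$ be an involution with $\lambda(\Pi_i)=\Pi_{n+1-i}$ for $i=1,\ldots,n$. An $\widetilde{A_n}$-triangle presentation compatible with $\lambda$ is a set $\mathcal T$ of triples $(u,v,w)$ of elements of $\Pi$ such that: (A) given $u,v\in\Pi$, $(u,v,w)\in\mathcal T$ for some $w\in\Pi$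 if and only if $\lambda(u)$ and $v$ are distinct and incident; (B) if $(u,v,w)\in\mathcal T$, then $(v,w,u)\in\mathcal T$; (C) if $(u,v,w_1),(u,v,w_2)\in\mathcal T$, then $w_1=w_2$; (D) if $(u,v,w)\in\mathcal T$, then $(\lambda(w),\lambda(v),\lambda(u))\in\mathcal T$; (E) if $(u,v,w)\in\mathcal T$, then $\dim(u)+\dim(v)+\dim(w)=n+1$ or $2(n+1)$; (F) if $(x,y,u)\in\mathcal T'$ and $(x',y',\lambda(u))\in\mathcal T'$, then for some $w\in\Pi$ we have $(y',x,w)\in\mathcal T'$ and $(y,x',\lambda(w))\in\mathcal T'$, where $\mathcal T'$ is the set of $(u,v,w)\in\mathcal T$ with $\dim(u)+\dim(v)+\dim(w)=n+1$. Group: $\Gamma_{\mathcal T}$ is the group with generators $a_v$, $v\in\Pi$, and relations $a_{\lambda(v)}=a_v^{-1}$ for all $v\in\Pi$ and $a_ua_va_w=1$ for all $(u,v,w)\in\mathcal T$. Normal form: $L$ is the set of all strings $u_1\cdots u_\ell$ over $\Pi$ (including the empty string) such that $\lambda(u_i)+u_{i+1}=\mathbf V$ for $i=1,\ldots,\ell-1$. It is known that $u_1\cdots u_\ell\mapsto a_{u_1}\cdots a_{u_\ell}$ is a bijection $L\to\Gamma_{\mathcal T}$; the string $u\in L$ mapping to $g$ is called the normal form of $g$. $d(g,g')=|g^{-1}g'|$ is the word metric with respect to the generators $a_v$, $v\in\Pi$. For $u=u_1\cdots u_\ell\in L$, $u(t)=a_{u_1}\cdots a_{u_t}$ for $0\le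 t\le\ell$ (with $u(0)=1$), and $u(t)=a_{u_1}\cdots a_{u_\ell}$ for $t>\ell$; similarly for $v$. *)

(* Defs.v *)
From HB Require Import structures.
From mathcomp Require Import all_boot.
From mathcomp Require Import boolp.
Set Implicit Arguments.
Unset Strict Implicit.
Unset Printing Implicit Defensive.

(* A line is identified with the set of its points.  The third axiom is that  *)
(* of Veblen and Young: if ab meets cd, then ac meets bd.                     *)
Record proj_space := ProjSpace {
  point : finType;
  lines : {set {set point}};
  line_uniq : forall p q : point, p != q ->
    exists! l : {set point}, [/\ l \in lines, p \in l & q \in l];
  line_card : forall l : {set point}, l \in lines -> 3 <= #|l|;
  veblen_young : forall (a b c d : point) (ab cd ac bd : {set point}),
    uniq [:: a; b; c; d] ->
    ab \in lines -> cd \in lines -> ac \in lines -> bd \in lines ->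
    a \in ab -> b \in ab -> c \in cd -> d \in cd ->
    a \in ac -> c \in ac -> b \in bd -> d \in bd ->
    ab :&: cd != set0 -> ac :&: bd != set0
}.

Section ProjectiveGeometry.
Variable V : proj_space.

Definition is_subspace (S : {set point V}) : bool :=
  [forall p in S, forall q in S, forall l in lines V,
     [&& p != q, p \in l & q \in l] ==> (l \subset S)].

Definition span (A : {set point V}) : {set point V} :=
  \bigcap_(S : {set point V} | is_subspace S && (A \subset S)) S.

(* For a subspace S: the least size of a set of points spanning S, that is,   *)
(* the projective dimension of S plus one.                                    *)
Definition rank (S : {set point V}) : nat :=
  #|[arg min_(A < S | span A == S) #|A|]|.

Definition pdim : nat := (rank [set: point V]).-1.

Record geometry := Geometry {
  gval :> {set point V};
  gvalP : [&& is_subspace gval, gval != set0 & gval != setT]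
}.

HB.instance Definition _ := [isSub for gval].
HB.instance Definition _ := [Finite of geometry by <:].

Definition dim (x : geometry) : nat := rank x.

Definition layer (i : nat) : {set geometry} := [set x | dim x == i].

Definition incident (x y : geometry) : bool := (x \subset y) || (y \subset x).

(* x + y = V, where V itself is not an element of the geometry. *)
Definition join_is_V (x y : geometry) : bool :=
  [forall z : geometry, ~~ ((x \subset z) && (y \subset z))].

Definition polar_involution (n : nat) (lambda : geometry -> geometry) : Prop :=
  involutive lambda /\
  (forall i, 1 <= i <= n -> lambda @: layer i = layer (n.+1 - i)).

Definition dimsum (t : geometry * geometry * geometry) : nat :=
  dim t.1.1 + dim t.1.2 + dim t.2.

Definition small_triples (n : nat) (T : {set geometry * geometry * geometry}) :=
  [set t in T | dimsum t == n.+1].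

Record triangle_presentation (n : nat) (lambda : geometry -> geometry)
    (T : {set geometry * geometry * geometry}) : Prop := TrianglePresentation {
  tpA : forall u v,
    (exists w, (u, v, w) \in T) <-> lambda u != v /\ incident (lambda u) v;
  tpB : forall u v w, (u, v, w) \in T -> (v, w, u) \in T;
  tpC : forall u v w1 w2, (u, v, w1) \in T -> (u, v, w2) \in T -> w1 = w2;
  tpD : forall u v w,
    (u, v, w) \in T -> (lambda w, lambda v, lambda u) \in T;
  tpE : forall u v w, (u, v, w) \in T ->
    dim u + dim v + dim w = n.+1 \/ dim u + dim v + dim w = 2 * n.+1;
  tpF : forall x y x' y' u,
    (x, y, u) \in small_triples n T ->
    (x', y', lambda u) \in small_triples n T ->
    exists w, (y', x, w) \in small_triples n T /\
              (y, x', lambda w) \in small_triples n T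
}.

Definition normal_string (lambda : geometry -> geometry) (s : seq geometry) :=
  sorted (fun u v => join_is_V (lambda u) v) s.

End ProjectiveGeometry.

Local Open Scope quotient_scope.
Local Open Scope group_scope.

(* A letter (x, false) stands for the generator x, and (x, true) for its      *)
(* formal inverse.  A presentation is a set of equations between words.       *)
Section PresentedGroup.
Variables (X : choiceType).
Notation word := (seq (X * bool)).
Variable R : word -> word -> Prop.

Inductive word_eqv : word -> word -> Prop :=
| eqv_refl w : word_eqv w w
| eqv_sym w1 w2 : word_eqv w1 w2 -> word_eqv w2 w1
| eqv_trans w1 w2 w3 : word_eqv w1 w2 -> word_eqv w2 w3 -> word_eqv w1 w3
| eqv_cat w1 w2 w1' w2' :
    word_eqv w1 w1' -> word_eqv w2 w2' -> word_eqv (w1 ++ w2) (w1' ++ w2')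
| eqv_cancel x b : word_eqv [:: (x, b); (x, ~~ b)] [::]
| eqv_rel w1 w2 : R w1 w2 -> word_eqv w1 w2.

Definition word_eqvb (w1 w2 : word) : bool := `[< word_eqv w1 w2 >].

Fact word_eqvb_refl : reflexive word_eqvb.
Proof. by move=> w; apply/asboolP; exact: eqv_refl. Qed.

Fact word_eqvb_sym : symmetric word_eqvb.
Proof. by move=> u v; apply/asboolP/asboolP; exact: eqv_sym. Qed.

Fact word_eqvb_trans : transitive word_eqvb.
Proof.
move=> v u w /asboolP uv /asboolP vw.
by apply/asboolP; apply: eqv_trans uv vw.
 Qed.

Canonical word_eqvb_equiv :=
  EquivRel word_eqvb word_eqvb_refl word_eqvb_sym word_eqvb_trans.

Definition presented : Type := {eq_quot word_eqvb}.

HB.instance Definition _ := Choice.copy presented {eq_quot word_eqvb}.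
HB.instance Definition _ := EqQuotient.copy presented {eq_quot word_eqvb}.

Definition inv_word (w : word) : word := rev [seq (l.1, ~~ l.2) | l <- w].

Definition pone : presented := \pi_presented [::].
Definition pmul (g h : presented) : presented :=
  \pi_presented (repr g ++ repr h).
Definition pinv (g : presented) : presented := \pi_presented (inv_word (repr g)).

Lemma pi_presentedP (u v : word) :
  \pi_presented u = \pi_presented v <-> word_eqv u v.
Proof.
split=> [/eqP|uv]; last by apply/eqmodP/asboolP.
by rewrite eqmodE => /asboolP.
Qed.

Lemma repr_pi (w : word) : word_eqv (repr (\pi_presented w)) w.
Proof. by apply/pi_presentedP; rewrite reprK. Qed.

Lemma pmul_pi (u v : word) :
  pmul (\pi_presented u) (\pi_presented v) = \pi_presented (u ++ v).
Proof. by apply/pi_presentedP; apply: eqv_cat; exact: repr_pi. Qed.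

Lemma inv_word_cat u v : inv_word (u ++ v) = inv_word v ++ inv_word u.
Proof. by rewrite /inv_word map_cat rev_cat. Qed.

Lemma inv_wordK : involutive inv_word.
Proof.
move=> w; rewrite /inv_word map_rev revK -map_comp -[RHS]map_id.
by apply: eq_map => -[x b] /=; rewrite negbK.
Qed.

Lemma word_eqvV w : word_eqv (w ++ inv_word w) [::].
Proof.
elim: w => [|[x b] w IHw]; first exact: eqv_refl.
have ww : word_eqv ((w ++ inv_word w) ++ [:: (x, ~~ b)]) ([::] ++ [:: (x, ~~ b)]).
  by apply: eqv_cat IHw _; exact: eqv_refl.
rewrite -cat1s inv_word_cat -catA (catA w).
apply: (eqv_trans _ (eqv_cancel x b)).
exact: (eqv_cat (eqv_refl [:: (x, b)]) ww).
Qed.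

Fact pmulA : associative pmul.
Proof.
move=> g h k; rewrite -[g]reprK -[h]reprK -[k]reprK.
by rewrite (pmul_pi (repr h)) (pmul_pi (repr g) (repr h)) !pmul_pi catA.
Qed.

Fact pmul1 : left_id pone pmul.
Proof. by move=> g; rewrite -[g]reprK pmul_pi. Qed.

Fact pmulg1 : right_id pone pmul.
Proof. by move=> g; rewrite -[g]reprK pmul_pi cats0. Qed.

Fact pmulV : left_inverse pone pinv pmul.
Proof.
move=> g; rewrite -{2}[g]reprK pmul_pi; apply/pi_presentedP.
by rewrite -{2}[repr g]inv_wordK; exact: word_eqvV.
Qed.

Fact pmulgV : right_inverse pone pinv pmul.
Proof.
move=> g; rewrite -{1}[g]reprK pmul_pi; apply/pi_presentedP.
exact: word_eqvV.
Qed.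

HB.instance Definition _ :=
  isGroup.Build presented pmulA pmul1 pmulg1 pmulV pmulgV.

Definition gen (x : X) : presented := \pi_presented [:: (x, false)].

Fact word_length_ex (g : presented) :
  exists n, `[< exists2 w : word, size w = n & \pi_presented w = g >].
Proof.
by exists (size (repr g)); apply/asboolP; exists (repr g); rewrite ?reprK.
Qed.

Definition word_length (g : presented) : nat := ex_minn (word_length_ex g).

Definition word_dist (g h : presented) : nat := word_length (g^-1 * h).

End PresentedGroup.

Record dfa (A : finType) := DFA {
  dstate : finType;
  dinit : dstate;
  dfinal : pred dstate;
  dtrans : dstate -> A -> dstate
}.

Definition accepts (A : finType) (M : dfa A) (w : seq A) : bool :=
  dfinal (foldl (@dtrans A M) (dinit M) w).

Definition regular (A : finType) (K : seq A -> Prop) : Prop :=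
  exists M : dfa A, forall w, accepts M w <-> K w.

(* The pair of words (u, v) as a word of pairs, where the shorter of u and v  *)
(* is padded at its end with None.                                            *)
Definition padded_pair (A : Type) (u v : seq A) : seq (option A * option A) :=
  [seq (onth u i, onth v i) | i <- iota 0 (maxn (size u) (size v))].

Definition regular_rel (A : finType) (K : seq A -> seq A -> Prop) : Prop :=
  regular (fun p : seq (option A * option A) =>
             exists u v, K u v /\ p = padded_pair u v).

(* Surjectivity of the evaluation on K makes the image of f a finite set of   *)
(* semigroup generators.                                                      *)
Definition automatic (G : groupType) : Prop :=
  exists (A : finType) (f : A -> G) (K : seq A -> Prop),
    let ev (w : seq A) := \prod_(a <- w) f a in
    [/\ regular K,
        forall g, exists2 w, K w & ev w = g,
        regular_rel (fun u v => [/\ K u, K v & ev u = ev v]) &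
        forall a, regular_rel (fun u v => [/\ K u, K v & ev u * f a = ev v])].

Section TriangleGroup.
Variables (V : proj_space) (lambda : geometry V -> geometry V).
Variable T : {set geometry V * geometry V * geometry V}.

Inductive triangle_rel :
    seq (geometry V * bool) -> seq (geometry V * bool) -> Prop :=
| rel_lambda v : triangle_rel [:: (lambda v, false)] [:: (v, true)]
| rel_triangle u v w : (u, v, w) \in T ->
    triangle_rel [:: (u, false); (v, false); (w, false)] [::].

Definition Gamma : groupType := presented triangle_rel.

Definition tgen (x : geometry V) : Gamma := gen triangle_rel x.

Definition teval (s : seq (geometry V)) : Gamma := \prod_(x <- s) tgen x.

(* take t s = s for t >= size s, so this is constant from there on. *)
Definition tprefix (s : seq (geometry V)) (t : nat) : Gamma := teval (take t s).

Definition tdist (g h : Gamma) : nat := word_dist g h.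

End TriangleGroup.

(* Main.v *)
Require Import Defs.
From HB Require Import structures.
From mathcomp Require Import all_boot.
From mathcomp Require Import zify boolp.
Set Implicit Arguments.
Unset Strict Implicit.
Unset Printing Implicit Defensive.

(** Call large the triples of [T] whose dimensions add up to [2 * n.+1], and
    read a large triple [(x, y, lambda z)] as [x * y = z].  By axioms (A) and
    (E) the product [x * y] is defined exactly when [y] properly contains
    [lambda x]; this step compares dimensions of nested subspaces, and is where
    the Veblen-Young axiom is needed, through the exchange property of spans
    [span_exchange] and the strict monotonicity of the rank [rank_proper].
    Adjoin the whole space as a unit and the empty subspace as an element
    [Delta] with [x * lambda x = Delta].  Axioms (B) and (C) say that the
    relation [x * y * z = Delta] is invariant under rotation and determines
    each of its arguments, axiom (F), dualised by (D), says that the product is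
    associative [large_assoc], and [x] divides [y] on the left precisely when
    the subspace [x] contains [y], so that divisibility is a lattice order.
    These are the simple elements of a Garside monoid in which [Delta] is
    central [triangle_germ]; the group is its group of fractions modulo
    [Delta], and the normal strings are the left greedy normal forms.

    To multiply a greedy word by a simple element [x] on the right, let the
    last letter absorb the largest possible divisor of [x], leave the rest of
    [x] behind, and multiply the preceding letters by the enlarged letter in
    the same way [gmulw].  The domino rule [domino] shows that the result is
    greedy, and [gmulw_mul] that two such multiplications compose as the
    elements do.  Hence the group acts on the reduced words [eqv_run]; the image
    of the empty word under a normal string is that string, so normal strings
    represent distinct elements [teval_inj], and the normal form of [u * x] is
    computed by [gmulw].

    As that computation proceeds from the end of the word to its beginning, all
    that reaches the prefix [u(t)] is a simple element.  Therefore [u(t)] and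
    [v(t)] differ by a simple element [fellow_traveller].  At most one
    [Delta] can emerge, at the front; removing it shifts the letters by one,
    and then [v(t)] is compared with the simple element one place later.
    An automaton that remembers this difference recognises multiplication by a
    generator [regular_fellow]. *)

(** * The rank of a subspace is strictly monotone *)

Section Rank.
Variable V : proj_space.
Implicit Types (p q a b : point V) (A B S l : {set point V}).

Lemma is_subspaceP S :
  reflect (forall p q l, p \in S -> q \in S -> p != q -> l \in lines V ->
             p \in l -> q \in l -> l \subset S) (is_subspace S).
Proof.
apply: (iffP forall_inP) => [H p q l pS qS pq lV pl ql | H p pS].
  have /forall_inP/(_ q qS)/forall_inP/(_ l lV) := H p pS.
  by rewrite pq pl ql.
apply/forall_inP => q qS; apply/forall_inP => l lV.
by apply/implyP => /and3P[pq pl ql]; apply: H pq lV pl ql.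
Qed.

Lemma sub_span A : A \subset span A.
Proof. by apply/bigcapsP => S /andP[]. Qed.

Lemma span_sub A S : is_subspace S -> A \subset S -> span A \subset S.
Proof. by move=> sS AS; apply: bigcap_inf; rewrite sS. Qed.

Lemma is_subspace_span A : is_subspace (span A).
Proof.
apply/is_subspaceP => p q l pA qA pq lV pl ql.
apply/bigcapsP => S /andP[sS AS].
have spanS := subsetP (span_sub sS AS).
by apply: (is_subspaceP _ sS) lV pl ql; rewrite ?spanS.
Qed.

Lemma span_id S : is_subspace S -> span S = S.
Proof. by move=> sS; apply/eqP; rewrite eqEsubset sub_span span_sub. Qed.

Lemma spanS A B : A \subset B -> span A \subset span B.
Proof.
move=> AB; apply: span_sub (is_subspace_span B) _.
exact: subset_trans AB (sub_span B).
Qed.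

Lemma is_subspace0 : is_subspace (set0 : {set point V}).
Proof. by apply/is_subspaceP => p q l; rewrite inE. Qed.

Lemma is_subspaceT : is_subspace [set: point V].
Proof. by apply/is_subspaceP => *; exact: subsetT. Qed.

Lemma line_ex p q : p != q ->
  exists l, [/\ l \in lines V, p \in l & q \in l].
Proof. by case/(@line_uniq V) => l [[? ? ?] _]; exists l. Qed.

Lemma line_eq p q l m : p != q -> l \in lines V -> m \in lines V ->
  p \in l -> q \in l -> p \in m -> q \in m -> l = m.
Proof.
case/(@line_uniq V) => k [_ kU] lV mV pl ql pm qm.
by rewrite -(kU l) // -(kU m).
Qed.

(** For a nonempty subspace [S], the join of [p] and [S] in explicit form;
    the exchange property is read off from it. *)
Definition cone p S : {set point V} :=
  p |: [set q | [exists s in S, exists l in lines V,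
                   [&& p \in l, s \in l & q \in l]]].

Lemma coneP p S q :
  reflect
    (q = p \/
     exists s l, [/\ s \in S, l \in lines V, p \in l, s \in l & q \in l])
    (q \in cone p S).
Proof.
rewrite !inE; apply: (iffP predU1P) => -[->|H]; [by left| |by left|].
  case/exists_inP: H => s sS /exists_inP[l lV /and3P[pl sl ql]].
  by right; exists s, l.
case: H => s [l [sS lV pl sl ql]].
right; apply/exists_inP; exists s => //; apply/exists_inP; exists l => //.
by rewrite pl sl.
Qed.

Section Cone.
Variables (p : point V) (S : {set point V}).
Hypotheses (sS : is_subspace S) (pS : p \notin S).

Let notp s : s \in S -> p != s.
Proof. by move=> sS'; apply: contraNneq pS => ->. Qed.

Lemma cone_line s l c : s \in S -> l \in lines V ->
  p \in l -> s \in l -> c \in l -> c \in cone p S.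
Proof. by move=> *; apply/coneP; right; exists s, l. Qed.

Lemma sub_cone : S \subset cone p S.
Proof.
apply/subsetP => s sS'; have [l [lV pl sl]] := line_ex (notp sS').
exact: (cone_line sS' lV pl sl sl).
Qed.

Lemma meet_cone c s t l : s \in S -> t \in S -> s != t -> c != p ->
  l \in lines V -> c \in l -> p \in l ->
  (forall st, st \in lines V -> s \in st -> t \in st -> l :&: st != set0) ->
  c \in cone p S.
Proof.
move=> sS' tS st cp lV cl pl H; have [m [mV sm tm]] := line_ex st.
have /set0Pn[r /setIP[rl rm]] := H m mV sm tm.
apply: cone_line _ lV pl rl cl.
by apply: (subsetP (is_subspaceP _ sS _ _ _ sS' tS st mV sm tm)).
Qed.

(** A line through a point [r] of [S] and a point [a] of the line [p s] lies
    in the plane of [p], [r], [s], where it meets each line through [p]. *)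
Lemma cone_join1 a r l : a \in cone p S -> a \notin S -> r \in S ->
  l \in lines V -> a \in l -> r \in l -> l \subset cone p S.
Proof.
move=> /coneP aC aS rS lV al rl; apply/subsetP => c cl.
case: aC => [ap|[s [m [sS' mV pm sm am]]]].
  by rewrite ap in al; exact: cone_line rS lV al rl cl.
have [->|cp] := eqVneq c p; first exact: setU11.
have [/(subsetP sub_cone) //|cS] := boolP (c \in S).
have as_ : a != s by apply: contraNneq aS => ->.
have [sl|sl] := boolP (s \in l).
  by apply: (cone_line sS' mV pm sm); rewrite -(line_eq as_ lV mV).
have rs : r != s by apply: contraNneq sl => <-.
have [k [kV ck pk]] := line_ex cp.
apply: (meet_cone rS sS' rs cp kV ck pk) => st stV r_st s_st.
apply: (@veblen_young V c r p s l m k st) => //; last first.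
  by apply/set0Pn; exists a; rewrite inE al.
rewrite /= !inE !negb_or cp rs (eq_sym r) !notp // !andbT.
by apply/andP; split; apply: contraNneq cS => ->.
Qed.

Lemma is_subspace_cone : is_subspace (cone p S).
Proof.
apply/is_subspaceP => a b l aC bC ab lV al bl.
have [aS|aS] := boolP (a \in S).
  have [bS|bS] := boolP (b \in S); last exact: (cone_join1 bC bS aS lV bl al).
  exact: subset_trans (is_subspaceP _ sS _ _ _ aS bS ab lV al bl) sub_cone.
have [bS|bS] := boolP (b \in S); first exact: (cone_join1 aC aS bS lV al bl).
have in_line s m : s \in S -> m \in lines V -> p \in m -> s \in m ->
    a \in m -> b \in m -> l \subset cone p S.
  move=> sS' mV pm sm am bm; apply/subsetP => c.
  rewrite (line_eq ab lV mV al bl am bm); exact: (cone_line sS' mV pm sm).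
case/coneP: (aC) => [ap|[s [m [sS' mV pm sm am]]]].
  case/coneP: bC => [bp|[t [m [tS mV pm tm bm]]]].
    by rewrite ap bp eqxx in ab.
  by apply: (in_line t m); rewrite ?ap.
case/coneP: bC => [bp|[t [k [tS kV pk tk bk]]]].
  by apply: (in_line s m); rewrite ?bp.
have [bm|bm] := boolP (b \in m); first exact: (in_line s m).
(* The lines [a s] and [b t] meet in [p], so the line [a b] meets [s t]. *)
have st : s != t.
  apply: contraNneq bm => st; rewrite -st in tk.
  by rewrite (line_eq (notp sS') mV kV).
have [h [hV sh th]] := line_ex st.
have: l :&: h != set0.
  apply: (@veblen_young V a s b t m k l h) => //; last first.
    by apply/set0Pn; exists p; rewrite inE pm.
  have neqS x y : x \notin S -> y \in S -> x != y.
    by move=> xS yS; apply: contraNneq xS => ->.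
  rewrite /= !inE !negb_or ab st (eq_sym s b) !neqS //.
case/set0Pn => r /setIP[rl rh].
have rS : r \in S.
  by apply: (subsetP (is_subspaceP _ sS _ _ _ sS' tS st hV sh th)).
exact: (cone_join1 aC aS rS lV al rl).
Qed.

End Cone.

(** A point [q] of the join of [p] and [span A] lies on a line [p s] with [s]
    in [span A], and then [p] lies on the line [q s]. *)
Lemma span_exchange A p q :
  q \in span (p |: A) -> q \notin span A -> p \in span (q |: A).
Proof.
have sA := is_subspace_span A; move=> qpA qA.
have AqA : span A \subset span (q |: A) by rewrite spanS ?subsetUr.
have [/(subsetP AqA) //|pA] := boolP (p \in span A).
have: q \in cone p (span A).
  apply: (subsetP _ _ qpA); apply: span_sub; first exact: is_subspace_cone.
  rewrite subUset sub1set setU11 /=.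
  exact: subset_trans (sub_span A) (sub_cone pA).
have qq : q \in span (q |: A) by rewrite (subsetP (sub_span _)) ?setU11.
case/coneP => [<- //|[s [l [sS lV pl sl ql]]]].
have qs : q != s by apply: contraNneq qA => ->.
have /is_subspaceP/(_ q s l qq (subsetP AqA s sS) qs lV ql sl) :=
  is_subspace_span (q |: A).
by move/subsetP; exact.
Qed.

Definition independent A := [forall a in A, a \notin span (A :\ a)].

Lemma independentU1 A b :
  independent A -> b \notin span A -> independent (b |: A).
Proof.
move=> /forall_inP iA bA; apply/forall_inP => a.
rewrite in_setU1; have [-> _|ab /= aA] := eqVneq a b.
  apply: contra bA; apply/subsetP/spanS.
  by apply/subsetP => x; rewrite !inE => /andP[/negPf ->].
apply: contra bA => aS; rewrite -(setD1K aA).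
apply: span_exchange (iA a aA).
suff -> : b |: A :\ a = (b |: A) :\ a by [].
apply/setP => x; rewrite !inE; case: (eqVneq x b) => // ->.
by rewrite eq_sym ab.
Qed.

Lemma independentS A B : A \subset B -> independent B -> independent A.
Proof.
move=> AB /forall_inP iB; apply/forall_inP => a aA.
apply: contra (iB a (subsetP AB a aA)); apply/subsetP/spanS.
exact: setSD.
Qed.

(** Steinitz exchange, by induction on the number of elements of [A] outside
    [B]: replace one of them by an element of [B]. *)
Lemma card_independent_le A B :
  independent A -> A \subset span B -> #|A| <= #|B|.
Proof.
have [m] := ubnP #|A :\: B|; elim: m A => // m IHm A lem iA AB.
have [sAB|/subsetPn[a aA aB]] := boolP (A \subset B).
  exact: subset_leq_card.
have aS := forall_inP iA a aA.
have /subsetPn[b bB bS] : ~~ (B \subset span (A :\ a)).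
  apply: contra aS => BS; apply: (subsetP _ _ (subsetP AB a aA)).
  exact: span_sub (is_subspace_span _) BS.
have bAa : b \notin A :\ a by apply: contra bS; apply/subsetP/sub_span.
rewrite (cardsD1 a) aA -[1 + _]/(true + _) -bAa -cardsU1; apply: IHm.
- rewrite -ltnS; apply: leq_trans lem; rewrite ltnS; apply: proper_card.
  apply/properP; split; last first.
    exists a; rewrite !inE ?aB ?aA // eqxx /= orbF.
    by apply: contraNneq aB => ->.
  apply/subsetP => x; rewrite !inE.
  by case: eqVneq => [->|_]; rewrite ?bB //= => /and3P[-> _ ->].
- by apply: independentU1 => //; apply: independentS iA; exact: subsetDl.
- rewrite subUset sub1set (subsetP (sub_span B)) //=.
  exact: subset_trans (subsetDl _ _) AB.
Qed.

Lemma rank_basis S : is_subspace S ->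
  exists A, [/\ span A = S, independent A & rank S = #|A|].
Proof.
move=> sS; rewrite /rank; case: arg_minnP => [|A /eqP As Amin].
  by rewrite span_id.
exists A; split=> //; apply/forall_inP => a aA; apply/negP => aS.
have: #|A| <= #|A :\ a|.
  apply: Amin; rewrite eqEsubset -{1}As spanS ?subsetDl //= -As.
  apply: span_sub (is_subspace_span _) _; rewrite -{1}(setD1K aA).
  by rewrite subUset sub1set aS sub_span.
by rewrite (cardsD1 a A) aA ltnn.
Qed.

(** A basis of [S] remains independent when a point of [S'] outside [S] is
    added to it. *)
Lemma rank_proper S S' : is_subspace S -> is_subspace S' ->
  S \proper S' -> rank S < rank S'.
Proof.
move=> sS sS' /properP[SS' [p pS' pS]].
have [A [As iA ->]] := rank_basis sS.
have [B [Bs _ ->]] := rank_basis sS'.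
have pA : p \notin A.
  by apply: contra pS; rewrite -As; exact/subsetP/sub_span.
rewrite -[_.+1]/(true + _) -pA -cardsU1; apply: card_independent_le.
  by apply: independentU1 => //; rewrite As.
rewrite Bs subUset sub1set pS' /=; apply: subset_trans SS'.
by rewrite -As sub_span.
Qed.

Lemma rank0 : rank (set0 : {set point V}) = 0.
Proof.
have s0 : span set0 == set0 :> {set point V} by rewrite span_id ?is_subspace0.
rewrite /rank; case: arg_minnP => [//|A _ /(_ _ s0)].
by rewrite cards0 leqn0 => /eqP.
Qed.

End Rank.

(** * Garside germs with a central Garside element *)

(** The simple elements of a Garside monoid whose Garside element [Delta] is
    central.  [gle] is left divisibility, [gcompl x] is the simple element with
    [x * gcompl x = Delta], and [gthird x y] completes [x * y] to [Delta].
    As [Delta] is central, the equation [x * y * z = Delta] is invariant under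
    rotation of [x, y, z]; this makes one operation and the three axioms
    [gthird_rot], [gthird1] and [gassoc] sufficient for both divisibility
    orders. *)
Record germ := Germ {
  simple :> eqType;
  gone : simple;
  gle : rel simple;
  gmeet : simple -> simple -> simple;
  gcompl : simple -> simple;
  gthird : simple -> simple -> simple;
  glexx : reflexive gle;
  gle_anti : antisymmetric gle;
  gle_trans : transitive gle;
  glexI : forall x y z, gle z (gmeet x y) = gle z x && gle z y;
  gcomplK : involutive gcompl;
  gle_complone : forall x, gle x (gcompl gone);
  gthird1 : forall x, gthird gone x = gcompl x;
  gthird_rot : forall x y, gle y (gcompl x) ->
    gle (gthird x y) (gcompl y) /\ gthird y (gthird x y) = x;
  gassoc : forall x y z,
    gle y (gcompl x) -> gle z (gthird x y) ->
    [/\ gle z (gcompl y), gle (gcompl (gthird y z)) (gcompl x) &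
        gthird x (gcompl (gthird y z)) = gthird (gcompl (gthird x y)) z]
}.

Section Germ.
Variable S : germ.
Implicit Types (a b c x y z : S) (w : seq S).
Local Notation one := (gone S).
Local Notation "~' x" := (gcompl x) (at level 35, format "~' x").
Local Notation top := (~' one).
Local Notation "x <=: y" := (gle x y) (at level 70).
Local Notation "x ^: y" := (gmeet x y) (at level 40).

(** The product [x * y] of the monoid is the simple element [z]. *)
Definition gprod x y z := y <=: ~' x /\ gthird x y = ~' z.

Definition gmul x y := ~' gthird x y.

(** The left quotient: [x = c * gquo c x] as soon as [c] divides [x]. *)
Definition gquo c x := gthird (~' x) c.

Lemma gprod_mul x y : y <=: ~' x -> gprod x y (gmul x y).
Proof. by move=> xy; split; rewrite // gcomplK. Qed.

Lemma gprod_rot x y z : gprod x y z -> gprod y (~' z) (~' x).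
Proof.
by case=> /gthird_rot[yz yx] e; rewrite e in yz yx; split; rewrite // gcomplK.
Qed.

Lemma gprod_rot2 x y z : gprod x y z -> gprod (~' z) x (~' y).
Proof. by move/gprod_rot/gprod_rot; rewrite !gcomplK. Qed.

Lemma gprod_fun x y z z' : gprod x y z -> gprod x y z' -> z = z'.
Proof. by move=> [_ e] [_ e']; apply: (can_inj (@gcomplK S)); rewrite -e. Qed.

Lemma gprod_injr x y y' z : gprod x y z -> gprod x y' z -> y = y'.
Proof.
move=> /gprod_rot2 e /gprod_rot2 e'; apply: (can_inj (@gcomplK S)).
exact: gprod_fun e e'.
Qed.

Lemma gprod_injl x x' y z : gprod x y z -> gprod x' y z -> x = x'.
Proof.
move=> /gprod_rot e /gprod_rot e'; apply: (can_inj (@gcomplK S)).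
exact: gprod_fun e e'.
Qed.

Lemma gprod_le_compl x y z : gprod x y z -> y <=: ~' x.
Proof. by case. Qed.

Lemma gprod_lel x y z : gprod x y z -> x <=: z.
Proof. by move/gprod_rot2/gprod_le_compl; rewrite gcomplK. Qed.

Lemma gprod_le_complr x y z : gprod x y z -> ~' z <=: ~' y.
Proof. by move/gprod_rot/gprod_le_compl. Qed.

Lemma gprod1l x : gprod one x x.
Proof. by split; rewrite ?gle_complone ?gthird1. Qed.

Lemma gprodr1 x : gprod x one x.
Proof. by have /gprod_rot2 := gprod1l (~' x); rewrite !gcomplK. Qed.

Lemma gprod_compl x : gprod x (~' x) top.
Proof. by have /gprod_rot := gprod1l x. Qed.

Lemma gle1x x : one <=: x.
Proof. exact: gprod_lel (gprod1l x). Qed.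

Lemma glex1 x : x <=: one -> x = one.
Proof. by move=> x1; apply: gle_anti; rewrite x1 gle1x. Qed.

Lemma gletopx x : top <=: x -> x = top.
Proof. by move=> x1; apply: gle_anti; rewrite x1 gle_complone. Qed.

Lemma gprod_quo c x : c <=: x -> gprod c (gquo c x) x.
Proof.
move=> cx; have: gprod (~' x) c (~' gquo c x).
  by split; rewrite gcomplK.
by move/gprod_rot; rewrite !gcomplK.
Qed.

(** Right divisibility is left divisibility of the complements, reversed. *)
Lemma gprod_quor y z : ~' z <=: ~' y -> exists x, gprod x y z.
Proof.
move=> /gprod_mul/gprod_rot2; rewrite gcomplK; set x := ~' _ => e.
by exists x.
Qed.

Lemma gprod_assoc x y z p q :  gprod x y p -> gprod p z q ->
  exists t, gprod y z t /\ gprod x t q.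
Proof.
move=> [yx e] [zp e']; have zxy : z <=: gthird x y by rewrite e.
have [zy xw E] := gassoc yx zxy; exists (gmul y z); split.
  exact: gprod_mul.
by split; rewrite // E e gcomplK.
Qed.

Lemma gprod_assocV x y z t q : gprod y z t -> gprod x t q ->
  exists p, gprod x y p /\ gprod p z q.
Proof.
(* Rotating the triples turns this direction into the other one. *)
move=> yz /gprod_rot xw; have [p [zp yp]] := gprod_assoc yz xw.
exists (~' p); split; first by have /gprod_rot2 := yp; rewrite gcomplK.
by have /gprod_rot2 := zp; rewrite !gcomplK.
Qed.

Lemma gle_prod2l c x y a b : gprod c x a -> gprod c y b ->
  (a <=: b) = (x <=: y).
Proof.
move=> ca cb; apply/idP/idP => [ab|xy].
  have [t [xt ct]] := gprod_assoc ca (gprod_quo ab).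
  by rewrite -(gprod_injr ct cb) (gprod_lel xt).
have [p [cp pw]] := gprod_assocV (gprod_quo xy) cb.
by rewrite (gprod_fun ca cp) (gprod_lel pw).
Qed.

Lemma gquo_id x : gquo x x = one.
Proof. exact: gprod_injr (gprod_quo (glexx x)) (gprodr1 x). Qed.

Lemma gquo1 x : gquo one x = x.
Proof. exact: gprod_injr (gprod_quo (gle1x x)) (gprod1l x). Qed.

Lemma gmul1 x : gmul x one = x.
Proof. exact: gprod_fun (gprod_mul (gle1x (~' x))) (gprodr1 x). Qed.

Lemma gmulx_compl x : gmul x (~' x) = top.
Proof. exact: gprod_fun (gprod_mul (glexx _)) (gprod_compl x). Qed.

Lemma gmeet_ler x y : y <=: x -> x ^: y = y.
Proof.
move=> yx; have := glexx (x ^: y); rewrite glexI => /andP[_ xy].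
by apply: gle_anti; rewrite xy glexI yx glexx.
Qed.

Lemma gmeet_topr x : x ^: top = x.
Proof.
apply: gle_anti; rewrite glexI glexx gle_complone !andbT.
by have := glexx (x ^: top); rewrite glexI => /andP[].
Qed.

Lemma gmeet_topl x : top ^: x = x.
Proof. exact/gmeet_ler/gle_complone. Qed.

Lemma gmeetl x y : x ^: y <=: x.
Proof. by have := glexx (x ^: y); rewrite glexI => /andP[]. Qed.

Lemma gmeetr x y : x ^: y <=: y.
Proof. by have := glexx (x ^: y); rewrite glexI => /andP[]. Qed.

(** If [c] and [u] have no common left divisor, then [c * v = u * q] is the
    least common left multiple of [v] and [q]: that multiple exists, its
    complement being the meet of the complements of [v] and [q], and its left
    quotient in [c * v = u * q] would divide both [c] and [u]. *)
Lemma gcompl_lcm c v u q t : gprod c v t -> gprod u q t -> u ^: c <=: one ->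
  ~' t = ~' v ^: ~' q.
Proof.
move=> cv uq uc1; pose m := ~' (~' v ^: ~' q).
have [c0 c0v] : exists c0, gprod c0 v m.
  by apply: gprod_quor; rewrite gcomplK gmeetl.
have [u0 u0q] : exists u0, gprod u0 q m.
  by apply: gprod_quor; rewrite gcomplK gmeetr.
have [e em] : exists e, gprod e m t.
  apply: gprod_quor; rewrite gcomplK glexI.
  by rewrite (gprod_le_complr cv) (gprod_le_complr uq).
have [c' [ec c'v]] := gprod_assocV c0v em.
have [u' [eu u'q]] := gprod_assocV u0q em.
rewrite (gprod_injl c'v cv) in ec; rewrite (gprod_injl u'q uq) in eu.
have e1 : e = one.
  apply/glex1/(gle_trans _ uc1).
  by rewrite glexI (gprod_lel ec) (gprod_lel eu).
by rewrite e1 in em; rewrite -(gprod_fun (gprod1l _) em) gcomplK.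
Qed.

(** ** Right multiplication of normal words by a simple element *)

(** Words are reversed: the head of the list is the last letter.  A word is
    left greedy when no letter can absorb a divisor of the next letter.  The
    letters [one] and [top] are allowed, so that [gmulw] below need not
    distinguish cases. *)
Definition normal_pair b a := ~' a ^: b <=: one.
Definition normal w := sorted normal_pair w.

(** The last letter [a] absorbs as much of [x] as it can, and the resulting
    letter is in turn multiplied into the word that precedes [a]. *)
Fixpoint gmulw w x : seq S :=
  if w is a :: w' then
    let c := ~' a ^: x in gquo c x :: gmulw w' (gmul a c)
  else [:: x].

Lemma normal_pair_absorb a x :
  normal_pair (gquo (~' a ^: x) x) (gmul a (~' a ^: x)).
Proof.
set c := _ ^: _; have ca : c <=: ~' a := gmeetl _ _.
have cx := gprod_quo (gmeetr (~' a) x : c <=: x).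
rewrite /normal_pair; set d := _ ^: gquo c x.
have /gprod_mul acd : d <=: ~' gmul a c := gmeetl _ _.
have [e [cd ae]] := gprod_assoc (gprod_mul ca) acd.
have de : d <=: gquo c x := gmeetr _ _.
have ex : e <=: x by rewrite (gle_prod2l cd cx).
have ec : e <=: c by rewrite glexI (gprod_le_compl ae).
by move: ec; rewrite (gle_prod2l cd (gprodr1 c)).
Qed.

(** The domino rule.  Let the word [f, a] be normal, let [a] absorb [c], and
    let [f] absorb [c1] from [b = a * c = c1 * b'].  A simple [g] for which
    [c * g] is simple can be absorbed by [b] as far as by its remainder [b'],
    because [c1] and [a] are left coprime and [gcompl_lcm] applies. *)
Lemma domino f a c g : normal_pair a f -> c <=: ~' a -> g <=: ~' c ->
  let b := gmul a c in
  ~' (gquo (~' f ^: b) b) ^: g = ~' b ^: g.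
Proof.
move=> fa ca gc b; set c1 := _ ^: b; set b' := gquo _ _.
have c1f : c1 <=: ~' f := gmeetl _ _.
have c1b := gprod_quo (gmeetr (~' f) b : c1 <=: b); rewrite -/b' in c1b.
have c1a : a ^: c1 <=: one.
  apply: gle_trans fa; rewrite glexI gmeetl andbT.
  exact: gle_trans (gmeetr _ _) c1f.
have e := gcompl_lcm c1b (gprod_mul ca) c1a.
apply: gle_anti; rewrite !glexI !gmeetr !andbT; apply/andP; split.
  rewrite e glexI gmeetl; exact: gle_trans (gmeetr _ _) gc.
exact: gle_trans (gmeetl _ _) (gprod_le_complr c1b).
Qed.

Lemma normal_gmulw w x : normal w -> normal (gmulw w x).
Proof.
elim: w x => [//|a w IHw] x naw /=.
have /(IHw (gmul a (~' a ^: x))) : normal w := path_sorted naw.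
case: w naw {IHw} => [|f w] /= naw; first by rewrite normal_pair_absorb.
move=> ->; rewrite andbT; case/andP: naw => fa _.
have := normal_pair_absorb a x; rewrite /normal_pair.
rewrite domino ?gmeetl //.
exact/gprod_le_compl/gprod_quo/gmeetr.
Qed.

Lemma gmulw_normal w x : normal (x :: w) -> gmulw w x = x :: w.
Proof.
elim: w x => [//|a w IHw] x /= /andP[ax naw].
by rewrite (glex1 ax) gquo1 gmul1 IHw.
Qed.

(** Greedy absorption by [a] from [z = c * e] may be done in two stages, because
    [d] divides [e] precisely when [c * d] divides [z]. *)
Lemma absorb2 a c e z : c <=: ~' a -> gprod c e z ->
  let d := ~' gmul a c ^: e in let c' := ~' a ^: z in
  gmul (gmul a c) d = gmul a c' /\ gquo d e = gquo c' z.
Proof.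
move=> ca ce d c'; have ac := gprod_mul ca.
have da : d <=: ~' gmul a c := gmeetl _ _.
have [h [cd ah]] := gprod_assoc ac (gprod_mul da).
have Eh : h = c'.
  apply: gle_anti; rewrite glexI (gprod_le_compl ah).
  rewrite (gle_prod2l cd ce) gmeetr /=.
  have cc' : c <=: c' by rewrite glexI ca (gprod_lel ce).
  have cq := gprod_quo cc'.
  rewrite (gle_prod2l cq cd) glexI -(gle_prod2l cq ce) gmeetr andbT.
  have [p [ap pq]] := gprod_assocV cq (gprod_mul (gmeetl (~' a) z)).
  by rewrite -(gprod_fun ap ac) (gprod_le_compl pq).
rewrite Eh in cd ah; split.
  exact: gprod_fun ah (gprod_mul (gprod_le_compl ah)).
have [p [cp pq]] := gprod_assocV (gprod_quo (gmeetr _ _ : d <=: e)) ce.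
rewrite (gprod_fun cp cd) in pq.
exact: gprod_injr pq (gprod_quo (gprod_lel pq)).
Qed.

(** Multiplying by [b = a * c] and then by [g] amounts to moving the part of
    [g] that [b] can absorb into [b] first: it suffices that [a] continues the
    normal word and that [c * g] is simple, by the domino rule. *)
Lemma gmulw_absorb w a c g :
  normal (a :: w) -> c <=: ~' a -> g <=: ~' c ->
  let b := gmul a c in let d := ~' b ^: g in
  gmulw (gmulw w b) g = gquo d g :: gmulw w (gmul b d).
Proof.
elim: w a c g => [//|f w IHw] a c g /= /andP[fa nfw] ca gc.
set b := gmul a c; rewrite domino // -/b; set d := ~' b ^: g.
set c1 := ~' f ^: b; congr (_ :: _).
have bd : gprod b d (gmul b d) := gprod_mul (gmeetl _ _).
have c1b := gprod_quo (gmeetr (~' f) b : c1 <=: b).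
have [e [b'd c1e]] := gprod_assoc c1b bd.
rewrite (gprod_fun (gprod_mul (gprod_le_compl b'd)) b'd).
have c1f : c1 <=: ~' f := gmeetl _ _.
rewrite (IHw f c1 e nfw c1f (gprod_le_compl c1e)) /=.
by have [-> ->] := absorb2 c1f c1e.
Qed.

(** The last letter of the first product absorbs all of [y], leaving a trivial
    letter behind; by [gmulw_absorb], what the other letters then absorb only
    completes the first multiplication to one by the simple element [x * y]. *)
Lemma gmulw_mul w x y : normal w -> y <=: ~' x ->
  gmulw (gmulw w x) y = one :: gmulw w (gmul x y).
Proof.
case: w => [_|a w naw] yx /=.
  by rewrite gmeet_ler // gquo_id.
set c := ~' a ^: x; have ca : c <=: ~' a := gmeetl _ _.
have cx : gprod c (gquo c x) x := gprod_quo (gmeetr _ _).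
have [z [x'y cz]] := gprod_assoc cx (gprod_mul yx).
have yx' := gprod_le_compl x'y.
rewrite gmeet_ler // gquo_id (gprod_fun (gprod_mul yx') x'y).
rewrite gmulw_absorb ?(gprod_le_compl cz) //=.
by have [-> ->] := absorb2 ca cz.
Qed.

Lemma gmulw_one w x : gmulw (one :: w) x = one :: gmulw w x.
Proof.
rewrite /= gmeet_ler ?gle_complone // gquo_id; congr (_ :: gmulw w _).
exact: gprod_fun (gprod_mul (gle_complone x)) (gprod1l x).
Qed.

Lemma gmulw_top w : gmulw w top = rcons w top.
Proof.
elim: w => [//|a w IHw] /=.
rewrite gmeet_topr gmulx_compl IHw; congr (_ :: _).
have := gprod_compl (~' a); rewrite gcomplK; apply: gprod_injr.
exact/gprod_quo/gle_complone.
Qed.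

Lemma size_gmulw w x : size (gmulw w x) = (size w).+1.
Proof. by elim: w x => //= a w IHw x; rewrite IHw. Qed.

(** The remainder that a letter [a] leaves is [top] only if it absorbs nothing
    from [top], and then [~' a] is trivial and [a] is [top]. *)
Lemma gmulw_rcons w x : top \notin w ->
  exists r y, gmulw w x = rcons r y /\ top \notin r.
Proof.
elim: w x => [|a w IHw] x /=; first by exists [::], x.
rewrite in_cons negb_or => /andP[aT /IHw{IHw} IHw].
have [r [y [-> rT]]] := IHw (gmul a (~' a ^: x)).
exists (gquo (~' a ^: x) x :: r), y; split=> //.
rewrite in_cons negb_or rT andbT; apply: contraNneq aT.
set c := _ ^: x => e; have /gprod_le_compl := gprod_quo (gmeetr _ _ : c <=: x).
rewrite -e => /gletopx/(can_inj (@gcomplK S)) c1.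
have xT : x = top.
  have := gprod_quo (gmeetr _ _ : c <=: x); rewrite -e c1 => h.
  exact: gprod_fun h (gprod1l _).
have : c = ~' a by rewrite /c xT gmeet_topr.
by rewrite c1 => ->; rewrite gcomplK.
Qed.

(** ** Normal words without trivial letters *)

Definition proper_letter x := (x != one) && (x != top).

Lemma normal_top w : normal (top :: w) -> w = nseq (size w) top.
Proof.
elim: w => [//|f w IHw] /= /andP[].
rewrite /normal_pair gmeet_topr => /glex1 f1.
have -> : f = top by rewrite -[f]gcomplK f1.
by move/IHw => {1}->.
Qed.

Lemma normal_pair_oner x : normal_pair x one -> x = one.
Proof. by rewrite /normal_pair gmeet_topl => /glex1. Qed.

Lemma filter_proper_top m : filter proper_letter (nseq m top) = [::].
Proof. by elim: m => //= m ->; rewrite /proper_letter eqxx andbF. Qed.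

Lemma normal_filter w : normal w -> normal (filter proper_letter w).
Proof.
elim: w => //= a w IHw naw; have nw := path_sorted naw.
case: ifP => [/andP[a1 _]|_]; last exact: IHw.
case: w naw nw IHw => //= f w /andP[af nfw] _ /(_ nfw).
case: ifP => [_ /= ->|]; first by rewrite af.
rewrite /proper_letter; have [f1|_ /=] := eqVneq f one.
  by rewrite f1 in af; rewrite (normal_pair_oner af) eqxx in a1.
have [fT _ _|//] := eqVneq f top.
by rewrite fT in nfw; rewrite (normal_top nfw) filter_proper_top.
Qed.

(** In a normal word the letters [top] come first and the letters [one] last,
    and an element that is multiplied in passes them without being changed. *)
Lemma filter_gmulw w x : normal w ->
  filter proper_letter (gmulw w x) =
    filter proper_letter (gmulw (filter proper_letter w) x).
Proof.
elim: w x => [//|a w IHw] x naw; have nw := path_sorted naw.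
rewrite [in RHS]/=; case: ifP => [_ /=|]; first by rewrite IHw.
rewrite /proper_letter; have [->|_ /=] := eqVneq a one.
  by rewrite gmulw_one /= /proper_letter eqxx IHw.
have [aT _|//] := eqVneq a top.
rewrite aT in naw *; rewrite [gmulw _ _]/= gcomplK (normal_top naw).
rewrite filter_proper_top.
have -> : one ^: x = one by apply: glex1; exact: gmeetl.
rewrite gquo1 gmul1 gmulw_top /= -cats1 filter_cat filter_proper_top /=.
by rewrite /proper_letter eqxx andbF.
Qed.

(** Right multiplication modulo the central element [top]. *)
Definition gact w x := filter proper_letter (gmulw w x).

Definition reduced w := normal w && all proper_letter w.

Lemma reduced_gact w x : normal w -> reduced (gact w x).
Proof.
move=> nw; rewrite /reduced filter_all andbT.
exact/normal_filter/normal_gmulw.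
Qed.

Lemma gact_mul w x y : normal w -> y <=: ~' x ->
  gact (gact w x) y = gact w (gmul x y).
Proof.
move=> nw yx; rewrite /gact -filter_gmulw; last exact: normal_gmulw.
by rewrite gmulw_mul //= /proper_letter eqxx.
Qed.

Lemma gact_top w : reduced w -> gact w top = w.
Proof.
case/andP=> _ /all_filterP pw.
rewrite /gact gmulw_top -cats1 filter_cat pw /=.
by rewrite /proper_letter eqxx andbF cats0.
Qed.

Lemma gactK w x : reduced w -> gact (gact w x) (~' x) = w.
Proof.
move=> rw; have /andP[nw _] := rw.
by rewrite gact_mul ?glexx // gmulx_compl gact_top.
Qed.

Lemma gact_reduced w x : reduced (x :: w) -> gact w x = x :: w.
Proof. by case/andP=> nxw /all_filterP pxw; rewrite /gact gmulw_normal. Qed.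

(** ** The fellow traveller property *)

Section FellowTraveller.
Variables (G : groupType) (f : S -> G).
Hypothesis fM : forall x y z, gprod x y z -> (f x * f y)%g = f z.
Hypothesis f_top : f top = 1%g.

Definition wval w : G := (\prod_(x <- w) f x)%g.

Lemma wval_cat w1 w2 : wval (w1 ++ w2) = (wval w1 * wval w2)%g.
Proof. exact: big_cat. Qed.

Lemma wval_rcons w x : wval (rcons w x) = (wval w * f x)%g.
Proof. by rewrite -cats1 wval_cat /wval big_seq1. Qed.

Lemma f_one : f one = 1%g.
Proof. by apply: (mulgI (f one)); rewrite (fM (gprod1l one)) mulg1. Qed.

Lemma wval_gmulw w x : wval (rev (gmulw w x)) = (wval (rev w) * f x)%g.
Proof.
elim: w x => [|a w IHw] x /=; first exact: (wval_rcons [::]).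
rewrite !rev_cons !wval_rcons IHw -(fM (gprod_mul (gmeetl _ _))).
by rewrite -!mulgA (fM (gprod_quo (gmeetr _ _))).
Qed.

Lemma wval_filter w : wval (filter proper_letter w) = wval w.
Proof.
elim: w => //= a w IHw; rewrite [in RHS]/wval big_cons -/(wval w) -IHw.
case: ifPn => [_|]; first by rewrite /wval big_cons.
by rewrite negb_and !negbK => /orP[] /eqP ->; rewrite ?f_one ?f_top mul1g.
Qed.

Lemma wval_gact w x : wval (rev (gact w x)) = (wval (rev w) * f x)%g.
Proof. by rewrite /gact -filter_rev wval_filter wval_gmulw. Qed.

Lemma gmulw_cat p q x : exists r y, gmulw (p ++ q) x = r ++ gmulw q y.
Proof.
elim: p x => [|a p IHp] x /=; first by exists [::], x.
have [r [y ->]] := IHp (gmul a (~' a ^: x)).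
by exists (gquo (~' a ^: x) x :: r), y.
Qed.

(** Multiplication changes the word from its end to its beginning: what
    reaches a prefix of the word is a simple element, and multiplies it. *)
Lemma gmulw_prefix w x t :
  let v := rev (gmulw w x) in let u := rev w in
  (exists s, wval (take t v) = wval (take t u) * f s)%g /\
  (exists s, wval (take t.+1 v) = wval (take t u) * f s)%g.
Proof.
move=> /=; have [tw|wt] := leqP t (size w); last first.
  rewrite !take_oversize ?size_rev ?size_gmulw ?(leqW wt) //; last exact: ltnW.
  by rewrite wval_gmulw; split; exists x.
pose q := drop (size w - t) w; have qt : size q = t by rewrite size_drop subKn.
have wE : w = take (size w - t) w ++ q by rewrite cat_take_drop.
have [r [y]] := gmulw_cat (take (size w - t) w) q x; rewrite -wE => ->.
rewrite wE !rev_cat {wE}.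
rewrite (take_size_cat _ (_ : size (rev q) = t)) ?size_rev //.
have qyt : size (rev (gmulw q y)) = t.+1 by rewrite size_rev size_gmulw qt.
rewrite (take_size_cat _ qyt) takel_cat ?qyt // {qyt}; split; last first.
  by exists y; rewrite wval_gmulw.
case: q qt => [<-|a q [<-]] /=.
  by exists one; rewrite f_one mulg1.
exists (~' a ^: y); rewrite !rev_cons -cats1.
rewrite take_size_cat ?size_rev ?size_gmulw // wval_gmulw wval_rcons.
by rewrite -mulgA (fM (gprod_mul (gmeetl _ _))).
Qed.

(** In a word without [top] the trivial letters are the last ones, so that
    removing them moves no other letter. *)
Lemma wval_take_filter w t : top \notin w ->
  sorted (fun a b => normal_pair b a) w ->
  wval (take t (filter proper_letter w)) = wval (take t w).
Proof.
elim: w t => [//|a w IHw] t; rewrite in_cons negb_or => /andP[aT wT] naw.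
have nw : sorted (fun a b => normal_pair b a) w := path_sorted naw.
rewrite /= {1}/proper_letter (eq_sym a top) aT andbT.
have [a1|_] := eqVneq a one; last first.
  by case: t => [|t] //=; rewrite /wval !big_cons -!/(wval _) IHw.
(* Only trivial letters follow a trivial letter. *)
have w1 : w = nseq (size w) one.
  move: naw; rewrite a1; elim: w {IHw wT nw} => //= b w IHw.
  by case/andP => /normal_pair_oner -> /IHw {1}->.
have ones m k : wval (take k (nseq m one)) = 1%g.
  elim: m k => [|m IHm] [|k] /=; rewrite /wval ?big_nil //.
  by rewrite big_cons f_one mul1g -/(wval _) IHm.
have -> : filter proper_letter w = [::].
  by rewrite w1; elim: (size w) => //= m ->; rewrite /proper_letter eqxx.
have -> : a :: w = nseq (size w).+1 one by rewrite a1 {1}w1.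
by rewrite ones /wval big_nil.
Qed.

(** If the first letter of the product is [top], its removal shifts the other
    letters by one, hence the two halves of [gmulw_prefix]. *)
Lemma fellow_traveller w x t : reduced w ->
  exists s, (wval (take t (rev (gact w x))) = wval (take t (rev w)) * f s)%g.
Proof.
case/andP=> nw pw; have nW := normal_gmulw x nw.
have wT : top \notin w.
  by apply/negP => /(allP pw); rewrite /proper_letter eqxx andbF.
have [r [y [E rT]]] := gmulw_rcons x wT.
have [[s Es] [s' Es']] := gmulw_prefix w x t.
rewrite /gact -filter_rev; rewrite /normal -rev_sorted in nW.
rewrite E rev_rcons in nW Es Es' *.
have [yT|yT] := eqVneq y top.
  exists s'; rewrite -Es' /= {1}/proper_letter yT eqxx andbF.
  rewrite /wval big_cons f_top mul1g -/(wval _) wval_take_filter ?mem_rev //.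
  exact: path_sorted nW.
exists s; rewrite -Es wval_take_filter //.
by rewrite in_cons negb_or mem_rev eq_sym yT.
Qed.

End FellowTraveller.
End Germ.

(** * The germ of a triangle presentation *)

Section TriangleGerm.
Variables (V : proj_space) (n : nat) (lambda : geometry V -> geometry V).
Variable T : {set geometry V * geometry V * geometry V}.
Hypotheses (hn : 2 <= n) (hV : pdim V = n).
Hypothesis hl : polar_involution n lambda.
Hypothesis hT : triangle_presentation n lambda T.
Implicit Types u v w x y z a b c : geometry V.

Let lambdaK : involutive lambda := hl.1.

Lemma gval_subspace x : is_subspace x.
Proof. by have /and3P[] := gvalP x. Qed.

Lemma gval_neq0 x : x != set0 :> {set _}.
Proof. by have /and3P[] := gvalP x. Qed.

Lemma gval_neqT x : x != setT :> {set _}.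
Proof. by have /and3P[] := gvalP x. Qed.

Lemma rankT : rank [set: point V] = n.+1.
Proof. by move: hV hn; rewrite /pdim; case: (rank _) => [<-|m /= ->]. Qed.

Lemma setT_neq0 : [set: point V] != set0.
Proof. by apply/eqP => T0; have := rankT; rewrite T0 rank0. Qed.

Lemma dim_gt0 x : 0 < dim x.
Proof.
rewrite -(rank0 V); apply: rank_proper (is_subspace0 V) (gval_subspace x) _.
by rewrite proper0 gval_neq0.
Qed.

Lemma dim_le x : dim x <= n.
Proof.
rewrite -ltnS -rankT; apply: rank_proper (gval_subspace x) (is_subspaceT V) _.
by rewrite properEneq gval_neqT subsetT.
Qed.

Lemma dim_lambda x : dim (lambda x) = n.+1 - dim x.
Proof.
have /hl.2 e : 1 <= dim x <= n by rewrite dim_gt0 dim_le.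
have : lambda x \in lambda @: layer V (dim x) by rewrite imset_f // inE.
by rewrite e inE => /eqP.
Qed.

Lemma geometry_properE x y : (x \proper y) = (x != y) && (x \subset y).
Proof. by rewrite properEneq. Qed.

Lemma dim_proper x y : x \proper y -> dim x < dim y.
Proof. exact: rank_proper (gval_subspace x) (gval_subspace y). Qed.

Definition large_triple u v w := ((u, v, w) \in T) && (lambda u \proper v).

(** As the rank is strictly monotone, the dimension sum tells in which of the
    two possible ways [lambda u] and [v] are incident. *)
Lemma triple_cases u v w : (u, v, w) \in T ->
  (v \proper lambda u /\ dim u + dim v + dim w = n.+1) \/
  (lambda u \proper v /\ dim u + dim v + dim w = 2 * n.+1).
Proof.
move=> uvw; have [uv inc] : lambda u != v /\ incident (lambda u) v.
  by apply/(tpA hT u v); exists w.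
have du := dim_lambda u; have := dim_le u; have := dim_le w.
have := dim_gt0 w; have [E|E] := tpE hT uvw => w0 wn un.
  left; split=> //; rewrite geometry_properE eq_sym uv /=.
  case/orP: inc => // s; have : lambda u \proper v.
    by rewrite geometry_properE uv.
  by move/dim_proper; lia.
right; split=> //; rewrite geometry_properE uv /=.
case/orP: inc => // s; have : v \proper lambda u.
  by rewrite geometry_properE eq_sym uv.
by move/dim_proper; lia.
Qed.

Lemma large_tripleE u v w : (u, v, w) \in T ->
  large_triple u v w = (dim u + dim v + dim w == 2 * n.+1).
Proof.
move=> uvw; rewrite /large_triple uvw /=.
case: (triple_cases uvw) => -[p ->]; last by rewrite p eqxx.
rewrite (negPf (_ : ~~ (lambda u \proper v))); first by apply/esym/eqP; lia.
by apply/negP => /proper_trans/(_ p); rewrite properxx.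
Qed.

Lemma large_small u v w :
  large_triple u v w -> (lambda w, lambda v, lambda u) \in small_triples n T.
Proof.
move=> uvw; have /andP[t _] := uvw; have := large_tripleE t.
rewrite uvw inE /dimsum (tpD hT t) /= !dim_lambda => /esym/eqP E.
by apply/eqP; have := dim_le u; have := dim_le v; have := dim_le w; lia.
Qed.

Lemma small_large u v w : (u, v, w) \in small_triples n T ->
  large_triple (lambda w) (lambda v) (lambda u).
Proof.
rewrite inE => /andP[t /eqP E]; rewrite /dimsum /= in E.
rewrite large_tripleE ?(tpD hT t) // !dim_lambda; apply/eqP.
by have := dim_le u; have := dim_le v; have := dim_le w; lia.
Qed.

Lemma small_rot u v w :
  (u, v, w) \in small_triples n T -> (v, w, u) \in small_triples n T.
Proof.
rewrite !inE => /andP[/(tpB hT) -> /eqP E]; rewrite /dimsum /= in E *.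
by apply/eqP; lia.
Qed.

Lemma large_rot u v w : large_triple u v w -> large_triple v w u.
Proof.
by move/large_small/small_rot/small_rot/small_large; rewrite !lambdaK.
Qed.

Lemma large_ex u v : lambda u \proper v -> exists w, large_triple u v w.
Proof.
move=> uv; have [|w uvw] := (tpA hT u v).2; last first.
  by exists w; rewrite /large_triple uvw.
rewrite /incident (proper_sub uv); split=> //.
by apply: contraTneq uv => ->; rewrite properxx.
Qed.

Lemma large_fun u v w w' : large_triple u v w -> large_triple u v w' -> w = w'.
Proof. by move=> /andP[t _] /andP[t' _]; apply: tpC hT _ _ _ _ t t'. Qed.

(** Read [large_triple x y (lambda z)] as [x * y = z]: axiom (F), dualised by
    axiom (D), is then one half of the associativity of this product. *)
Lemma large_assoc a b p c q :
  large_triple a b (lambda p) -> large_triple p c (lambda q) ->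
  exists w, large_triple b c (lambda w) /\ large_triple a w (lambda q).
Proof.
move=> /large_small; rewrite lambdaK => /small_rot abp.
move=> /large_small; rewrite lambdaK => pcq.
have ba : (lambda b, lambda a, p) \in small_triples n T := abp.
have [w [cb aq]] := tpF hT ba pcq.
exists w; split.
  by have := small_large cb; rewrite !lambdaK => /large_rot.
by have := small_large aq; rewrite !lambdaK => /large_rot/large_rot.
Qed.

(** The simple elements: [Full] is the unit, and [Empty] is [Delta]. *)
Inductive subsp := Full | Empty | Proper of geometry V.

Definition subsp_code (s : subsp) :=
  match s with
  | Full => None | Empty => Some None | Proper x => Some (Some x)
  end.

Definition subsp_decode o :=
  match o with
  | None => Full | Some None => Empty | Some (Some x) => Proper x
  end.

Lemma subsp_codeK : cancel subsp_code subsp_decode. Proof. by case. Qed.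

HB.instance Definition _ := Equality.copy subsp (can_type subsp_codeK).

Definition sset (s : subsp) : {set point V} :=
  match s with Full => setT | Empty => set0 | Proper x => x end.

Definition to_subsp (A : {set point V}) : subsp :=
  if insub A is Some x then Proper x else if A == set0 then Empty else Full.

Lemma sset_subspace s : is_subspace (sset s).
Proof.
case: s => [||x]; [exact: is_subspaceT | exact: is_subspace0 |].
exact: gval_subspace.
Qed.

Lemma sset_inj : injective sset.
Proof.
move=> [||x] [||y] //= e.
- by have := setT_neq0; rewrite e eqxx.
- by have := gval_neqT y; rewrite -e eqxx.
- by have := setT_neq0; rewrite -e eqxx.
- by have := gval_neq0 y; rewrite -e eqxx.
- by have := gval_neqT x; rewrite e eqxx.
- by have := gval_neq0 x; rewrite e eqxx.
- by congr Proper; apply: val_inj.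
Qed.

Lemma to_subspK A : is_subspace A -> sset (to_subsp A) = A.
Proof.
rewrite /to_subsp => sA; case: insubP => [x _ //|]; rewrite sA /=.
by case: eqP => [-> //|_] /=; rewrite negbK => /eqP.
Qed.

(** Reverse inclusion, so that the meet of two simple elements is the join of
    the subspaces: a pair of proper subspaces [u], [v] is normal for the germ
    precisely when the join of [lambda u] and [v] is the whole space. *)
Definition sle s t := sset t \subset sset s.
Definition smeet s t := to_subsp (span (sset s :|: sset t)).
Definition scompl s :=
  match s with
  | Full => Empty | Empty => Full | Proper x => Proper (lambda x)
  end.

(** In the last two branches the product of [s] and [t] is undefined, and
    [Empty] is a default value. *)
Definition sthird s t :=
  match s, t with
  | Full, _ => scompl t
  | _, Full => scompl s
  | Proper x, Proper y =>
      if lambda x == y then Full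
      else if [pick z | large_triple x y z] is Some z then Proper z else Empty
  | _, _ => Empty
  end.

Lemma sle_refl : reflexive sle. Proof. by move=> s; exact: subxx. Qed.

Lemma sle_anti : antisymmetric sle.
Proof.
by move=> s t; rewrite andbC => st; apply/sset_inj/eqP; rewrite eqEsubset.
Qed.

Lemma sle_trans : transitive sle.
Proof. by move=> t s r ts rt; exact: subset_trans rt ts. Qed.

Lemma sleI s t r : sle r (smeet s t) = sle r s && sle r t.
Proof.
rewrite /sle to_subspK ?is_subspace_span // -subUset.
apply/idP/idP; first exact: subset_trans (sub_span _).
exact: span_sub (sset_subspace r).
Qed.

Lemma scomplK : involutive scompl.
Proof. by case=> //= x; rewrite lambdaK. Qed.

Lemma sthird_large a b c : large_triple a b c ->
  sthird (Proper a) (Proper b) = Proper c.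
Proof.
move=> abc /=; case: eqP => [e|_].
  by case/andP: abc; rewrite e properxx.
case: pickP => [c' /(large_fun abc) -> //|/(_ c)]; by rewrite abc.
Qed.

Lemma sthirdFull s : sthird s Full = scompl s.
Proof. by case: s. Qed.

Lemma sthird_compl s : sthird s (scompl s) = Full.
Proof. by case: s => //= x; rewrite eqxx. Qed.

Lemma sle_compl_cases a s : sle s (scompl (Proper a)) ->
  [\/ s = Full, s = Proper (lambda a) |
      exists b c, s = Proper b /\ large_triple a b c].
Proof.
case: s => [||b] /=; first by constructor 1.
  by rewrite /sle /= subset0 (negPf (gval_neq0 _)).
rewrite /sle /= => ab; have [<-|nab] := eqVneq (lambda a) b.
  by constructor 2.
have /large_ex[c abc] : lambda a \proper b by rewrite geometry_properE nab.
by constructor 3; exists b, c.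
Qed.

Lemma sle_Full s : sle s Full -> s = Full.
Proof.
by move=> h; apply: sset_inj; apply/eqP; rewrite eqEsubset subsetT.
Qed.

Lemma sle_Empty s : sle s Empty. Proof. exact: sub0set. Qed.

Lemma sthird_rot s t : sle t (scompl s) ->
  sle (sthird s t) (scompl t) /\ sthird t (sthird s t) = s.
Proof.
case: s => [_||a].
  by rewrite /= sthird_compl; split; first exact: sle_refl.
  by move/sle_Full => ->; split=> //; exact: sle_Empty.
case/sle_compl_cases => [->|->|[b [c [-> abc]]]].
- by split; rewrite ?sle_Empty //= lambdaK.
- by rewrite /= eqxx lambdaK; split => //; exact: subsetT.
- have bca := large_rot abc.
  rewrite (sthird_large abc) (sthird_large bca); split=> //.
  by case/andP: bca => _ ?; exact: proper_sub.
Qed.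

Lemma sassoc s t r : sle t (scompl s) -> sle r (sthird s t) ->
  [/\ sle r (scompl t), sle (scompl (sthird t r)) (scompl s) &
      sthird s (scompl (sthird t r)) = sthird (scompl (sthird s t)) r].
Proof.
case: s => [_ /= h||a].
- by rewrite !scomplK; split; rewrite ?sle_Empty.
- move=> /sle_Full -> /sle_Full ->.
  by split=> //; [exact: sle_Empty | exact: sle_refl].
case/sle_compl_cases => [->|->|[b [c [-> abc]]]].
- by rewrite sthirdFull scomplK /= !scomplK => ?; split; rewrite ?sle_Empty.
- rewrite -/(scompl (Proper a)) sthird_compl => /sle_Full ->.
  rewrite !sthirdFull !scomplK sthird_compl; split=> //; last exact: sle_refl.
  exact: subsetT.
have bca := large_rot abc.
rewrite (sthird_large abc) -{1}(scomplK (Proper c)).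
case/sle_compl_cases => [->|->|[d [e [-> cde]]]].
- rewrite !sthirdFull !scomplK (sthird_large abc); split=> //.
    exact: subsetT.
  by case/andP: abc => _ /proper_sub.
- rewrite lambdaK (sthird_large bca) sthird_compl /= lambdaK !eqxx.
  split=> //; last exact: sle_refl.
  by case/andP: bca => _ ?; exact: proper_sub.
rewrite -[c]lambdaK in abc; rewrite -[e]lambdaK in cde.
have [w [bdw awe]] := large_assoc abc cde.
have -> : sthird (Proper b) (Proper d) = scompl (Proper w).
  exact: sthird_large bdw.
rewrite scomplK (sthird_large awe) (sthird_large cde).
split=> //; first by case/andP: bdw => _ /proper_sub.
by case/andP: awe => _ /proper_sub.
Qed.

Definition triangle_germ : germ :=
  @Germ subsp Full sle smeet scompl sthird sle_refl sle_anti sle_trans sleI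
    scomplK sle_Empty (fun=> erefl) sthird_rot sassoc.

Lemma join_normal u v : join_is_V (lambda u) v =
  @normal_pair triangle_germ (Proper v) (Proper u).
Proof.
rewrite /normal_pair /= /sle /=.
rewrite to_subspK ?is_subspace_span // subTset; apply/forallP/eqP => [H|E z].
  apply/eqP/negPn/negP => nT.
  have uvs := sub_span (lambda u :|: v).
  have s0 : span (lambda u :|: v) != set0.
    apply: contraNneq (gval_neq0 v) => s0; rewrite s0 in uvs.
    by rewrite -subset0; apply: subset_trans uvs; exact: subsetUr.
  have gs : [&& is_subspace (span (lambda u :|: v)),
    span (lambda u :|: v) != set0 & span (lambda u :|: v) != setT].
    by rewrite is_subspace_span s0.
  by have := H (Geometry gs); rewrite /= -subUset uvs.
rewrite -subUset; apply: contra (gval_neqT z) => uvz.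
by rewrite -subTset -E span_sub ?gval_subspace.
Qed.

End TriangleGerm.

Local Open Scope group_scope.

(** * Regular languages and automatic structures *)

Section Regular.
Variable A : finType.
Implicit Types (K : seq A -> Prop) (w : seq A).

Lemma regular_ext K K' : (forall w, K w <-> K' w) -> regular K -> regular K'.
Proof.
by move=> KK' [M MP]; exists M => w; rewrite MP.
Qed.

Lemma regular_and K K' : regular K -> regular K' ->
  regular (fun w => K w /\ K' w).
Proof.
move=> [M MP] [M' MP']; pose trans s a :=
  (dtrans (d := M) s.1 a, dtrans (d := M') s.2 a).
pose final (s : dstate M * dstate M') := dfinal s.1 && dfinal s.2.
exists (DFA (dinit M, dinit M') final trans) => w.
rewrite -MP -MP' /accepts /= (rwP andP).
suff -> s s' : foldl trans (s, s') w =
  (foldl (dtrans (d := M)) s w, foldl (dtrans (d := M')) s' w) by [].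
by elim: w s s' => //= a w IHw s s'; rewrite IHw.
Qed.

(** A language given by conditions on single letters and on consecutive
    letters: the automaton remembers the last letter. *)
Lemma regular_local (P : pred A) (r : rel A) :
  regular (fun w => all P w && sorted r w).
Proof.
pose trans (s : option (option A)) b :=
  if s is Some s' then
    if P b && (if s' is Some a then r a b else true) then Some (Some b)
    else None
  else None.
exists (@DFA A _ (Some None) isSome trans) => w; rewrite /accepts /=.
have None_stuck v : foldl trans None v = None by elim: v.
case: w => //= a w; case: (P a) => /=; last by rewrite None_stuck.
suff -> : isSome (foldl trans (Some (Some a)) w) = all P w && path r a w by [].
elim: w a => //= b w IHw a; case: (P b) => /=; last by rewrite None_stuck.
by case: (r a b) => /=; [exact: IHw | rewrite None_stuck andbF].
Qed.

End Regular.

Section PaddedPair.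
Variables (A : finType).
Implicit Types (u v : seq A).

Lemma padded_pair_cons u v : (0 < maxn (size u) (size v))%N ->
  padded_pair u v = (ohead u, ohead v) :: padded_pair (behead u) (behead v).
Proof.
have onthS (s : seq A) i : onth s i.+1 = onth (behead s) i.
  by case: s => [|a s]; case: i.
rewrite /padded_pair !size_behead.
have -> : maxn (size u).-1 (size v).-1 = (maxn (size u) (size v)).-1.
  by case: (size u) (size v) => [|m] [|k]; rewrite ?max0n ?maxn0 ?maxnSS.
case: (maxn _ _) => //= N _; congr (_ :: _).
by rewrite (iotaDl 1 0) -map_comp; apply: eq_map => i /=; rewrite -!onthS.
Qed.

Variable r : rel A.

Definition padded_rel (x y : option A) : bool :=
  match x, y with
  | Some a, Some b => r a b
  | None, Some _ => false
  | _, None => true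
  end.

Definition padded_rel2 (x y : option A * option A) :=
  padded_rel x.1 y.1 && padded_rel x.2 y.2.

(** Correct padding is a condition on consecutive letters, except that no
    letter may pad both words at once. *)
Lemma sorted_padded (p : seq (option A * option A)) :
  (all (predC1 (None, None)) p && sorted padded_rel2 p) <->
  exists u v, [/\ sorted r u, sorted r v & p = padded_pair u v].
Proof.
split.
  elim: p => [_|[x y] p IHp /= /andP[/andP[xy allp] pp]].
    by exists [::], [::].
  have [|u [v [su sv Ep]]] := IHp; first by rewrite allp (path_sorted pp).
  have [xu yv] : padded_rel x (ohead u) /\ padded_rel y (ohead v).
    move: pp; rewrite Ep.
    have [|/padded_pair_cons ->] := posnP (maxn (size u) (size v)).
      case: u v {su sv Ep} => [|? u] [|? v];
        rewrite ?maxn0 ?max0n ?maxnSS //.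
      by case: x xy; case: y.
    by case/andP => /andP[].
  pose add (x : option A) s := if x is Some a then a :: s else s.
  have addP z s : sorted r s -> padded_rel z (ohead s) ->
      [/\ sorted r (add z s), ohead (add z s) = z & behead (add z s) = s].
    by case: z s => [a|] [|b s] //= -> ->.
  have [su' hu tu] := addP x u su xu; have [sv' hv tv] := addP y v sv yv.
  exists (add x u), (add y v); split=> //.
  rewrite padded_pair_cons ?hu ?hv ?tu ?tv ?Ep //.
  by case: x y xy {xu yv su' sv' hu hv tu tv pp} => [a|] [b|] //= _;
    rewrite ?maxnSS // leq_max ?orbT.
case=> u [v [su sv ->]].
have [m] := ubnP (maxn (size u) (size v)).
elim: m u v su sv => // m IHm u v su sv lem.
have [/eqP|pos] := posnP (maxn (size u) (size v)).
  by rewrite -leqn0 geq_max !leqn0 !size_eq0 => /andP[/eqP -> /eqP ->].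
rewrite padded_pair_cons //=.
have sb s : sorted r s -> sorted r (behead s).
  by case: s => //= a s /path_sorted.
have ob s : sorted r s -> padded_rel (ohead s) (ohead (behead s)).
  by case: s => [|a [|b s]] //= /andP[].
set q := padded_pair (behead u) (behead v).
have /andP[-> sp] : all (predC1 (None, None)) q && sorted padded_rel2 q.
  apply: IHm (sb _ su) (sb _ sv) _; rewrite !size_behead; move: lem pos.
  by case: (size u) (size v) => [|i] [|j]; rewrite ?max0n ?maxn0 ?maxnSS.
apply/andP; split.
  by move: pos; case: (u) (v) => [|a u'] [|b v'].
have [/eqP|pos'] := posnP (maxn (size (behead u)) (size (behead v))).
  by rewrite /q -leqn0 geq_max !leqn0 !size_eq0 => /andP[/eqP -> /eqP ->].
move: sp; rewrite /q padded_pair_cons //= => ->; rewrite andbT.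
by rewrite /padded_rel2 /= !ob.
Qed.

End PaddedPair.

(** The automaton reads two words in parallel and remembers the difference of
    the prefixes read so far, which has to stay among the finitely many values
    of [g]. *)
Section Difference.
Variables (A B : finType) (G : groupType) (f : A -> G) (g : B -> G) (b1 : B).
Hypothesis g1 : g b1 = 1.

Let ev (w : seq A) : G := \prod_(a <- w) f a.
Let letter (x : option A) : G := if x is Some a then f a else 1.

Definition diff_step (d : G) (l : option A * option A) : G :=
  (letter l.1)^-1 * d * letter l.2.

Lemma diff_padded d u v i :
  foldl diff_step d (take i (padded_pair u v)) =
    (ev (take i u))^-1 * d * ev (take i v).
Proof.
have evS s k : ev (take k.+1 s) = letter (ohead s) * ev (take k (behead s)).
  by case: s => [|a s] /=; rewrite /ev ?big_nil ?mul1g ?big_cons.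
elim: i u v d => [|i IHi] u v d.
  by rewrite !take0 /ev big_nil invg1 mul1g mulg1.
have [/eqP|pos] := posnP (maxn (size u) (size v)).
  rewrite -leqn0 geq_max !leqn0 !size_eq0 => /andP[/eqP -> /eqP ->] /=.
  by rewrite /ev big_nil invg1 mul1g mulg1.
by rewrite padded_pair_cons //= IHi !evS invgM /diff_step /= !mulgA.
Qed.

Lemma diff_padded_all d u v :
  foldl diff_step d (padded_pair u v) = (ev u)^-1 * d * ev v.
Proof.
have := diff_padded d u v (maxn (size u) (size v)).
rewrite !take_oversize ?leq_maxl ?leq_maxr //.
by rewrite size_map size_iota.
Qed.

Lemma regular_diff (h : G) :
  regular (fun p => (forall i, exists b, foldl diff_step 1 (take i p) = g b) /\
                    foldl diff_step 1 p = h).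
Proof.
pose trans (s : option B) l :=
  if s is Some b then [pick b' | `[< diff_step (g b) l = g b' >]] else None.
pose final s := if s is Some b then `[< g b = h >] else false.
exists (@DFA _ _ (Some b1) final trans) => p.
rewrite /accepts /= -g1.
have None_stuck q : foldl trans None q = None by elim: q.
elim: p b1 => [|l p IHp] b /=.
  by split=> [/asboolP|[_ /asboolP //]]; split=> // _; exists b.
case: pickP => [b' /asboolP E|no]; last first.
  rewrite None_stuck; split=> // -[/(_ 1%N)[b']]; rewrite /= take0 /= => E.
  by have /asboolP := no b'; rewrite E.
rewrite IHp E; split=> -[H ->]; split=> // i; last first.
  by have := H i.+1; rewrite /= E.
by case: i => [|i] /=; [exists b | rewrite E].
Qed.

Lemma regular_fellow (r : rel A) (h : G) :
  (forall u v, sorted r u -> sorted r v -> ev u * h = ev v ->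
     forall t, exists b, (ev (take t u))^-1 * ev (take t v) = g b) ->
  regular_rel (fun u v => [/\ sorted r u, sorted r v & ev u * h = ev v]).
Proof.
move=> fellow.
apply: regular_ext (regular_and
  (regular_local (predC1 (None, None)) (padded_rel2 r)) (regular_diff h)) => p.
split=> [[/sorted_padded[u [v [su sv ->]]] [_]]|[u [v [[su sv E] ->]]]].
  rewrite diff_padded_all mulg1 => <-; exists u, v; split=> //; split=> //.
  by rewrite mulVKg.
split; first by apply/sorted_padded; exists u, v.
split=> [i|]; last by rewrite diff_padded_all mulg1 -E mulKg.
by rewrite diff_padded mulg1; exact: fellow.
Qed.

End Difference.

Local Open Scope quotient_scope.

(** * The group of a triangle presentation *)

Lemma word_length_le (X : choiceType)
    (R : seq (X * bool) -> seq (X * bool) -> Prop) w :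
  (word_length (\pi_(presented R) w) <= size w)%N.
Proof.
by rewrite /word_length; case: ex_minnP => m _; apply; apply/asboolP; exists w.
Qed.

Section TriangleNormalForm.
Variables (V : proj_space) (n : nat) (lambda : geometry V -> geometry V).
Variable T : {set geometry V * geometry V * geometry V}.
Hypotheses (hn : 2 <= n) (hV : pdim V = n).
Hypothesis hl : polar_involution n lambda.
Hypothesis hT : triangle_presentation n lambda T.
Implicit Types (x y : geometry V) (u v : seq (geometry V)).
Implicit Types (l : geometry V * bool) (w : seq (geometry V * bool)).

Local Notation S := (triangle_germ hn hV hl hT).
Local Notation Gamma := (Gamma lambda T).
Local Notation tgen := (tgen lambda T).
Local Notation teval := (teval lambda T).
Local Notation eqv := (word_eqv (triangle_rel lambda T)).

Let lambdaK : involutive lambda := hl.1.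
Let prop x : S := Proper x.
Let prop_inj : injective prop. Proof. by move=> x y []. Qed.

Lemma tgenV x : tgen (lambda x) = (tgen x)^-1.
Proof.
apply: (mulIg (tgen x)); rewrite mulVg.
have -> : tgen (lambda x) =
    \pi_(presented (triangle_rel lambda T)) [:: (x, true)].
  exact/pi_presentedP/eqv_rel/rel_lambda.
by rewrite [LHS]pmul_pi; apply/pi_presentedP; exact: (eqv_cancel _ x true).
Qed.

Lemma tgen_triangle x y z : (x, y, z) \in T -> tgen x * tgen y = (tgen z)^-1.
Proof.
move=> xyz; apply: (mulIg (tgen z)); rewrite mulVg.
rewrite [tgen x * _]pmul_pi [LHS]pmul_pi; apply/pi_presentedP.
exact/eqv_rel/rel_triangle.
Qed.

Definition sgen (s : S) : Gamma := if s is Proper x then tgen x else 1.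

Lemma sgenM (s t r : S) : gprod s t r -> sgen s * sgen t = sgen r.
Proof.
case=> ts E; have -> : r = gcompl (gthird s t) by rewrite E gcomplK.
case: s ts {E} => [_||a].
- by rewrite mul1g [gcompl _](scomplK hl).
- by move/(sle_Full hn hV) => -> /=; rewrite mulg1.
case/(sle_compl_cases hT) => [->|->|[b [c [-> abc]]]].
- by rewrite /= lambdaK mulg1.
- by rewrite [gthird _ _](sthird_compl lambda T (Proper a)) /= tgenV mulgV.
- rewrite [gthird _ _](sthird_large hT abc) /= tgenV.
  by apply: tgen_triangle; case/andP: abc.
Qed.

Definition letter l := if l.2 then lambda l.1 else l.1.

Definition run (s : seq S) w : seq S :=
  foldl (fun s l => gact s (prop (letter l))) s w.

Lemma reduced_run s w : reduced s -> reduced (run s w).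
Proof.
by elim: w s => //= l w IHw s /andP[ns _]; apply/IHw/reduced_gact.
Qed.

Lemma run_cancel (s : seq S) x : reduced s ->
  gact (gact s (prop x)) (prop (lambda x)) = s.
Proof. exact: (@gactK S). Qed.

Lemma run_large (s : seq S) x y z : reduced s -> large_triple lambda T x y z ->
  gact (gact (gact s (prop x)) (prop y)) (prop z) = s.
Proof.
move=> rs xyz; have /andP[ns _] := rs.
have yx : gle (prop y) (gcompl (prop x)).
  by case/andP: xyz => _ /proper_sub.
rewrite (gact_mul ns yx) {1}/gmul [gthird _ _](sthird_large hT xyz).
by have := gactK (gcompl (prop z)) rs; rewrite gcomplK.
Qed.

Lemma run_triangle (s : seq S) x y z : reduced s -> (x, y, z) \in T ->
  gact (gact (gact s (prop x)) (prop y)) (prop z) = s.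
Proof.
move=> rs xyz; case: (triple_cases hn hV hl hT xyz) => -[p E]; last first.
  by apply: run_large => //; rewrite /large_triple xyz.
(* The inverses of the letters of a small triple form a large triple. *)
have lgt : large_triple lambda T (lambda z) (lambda y) (lambda x).
  by apply: (small_large hn hV hl hT); rewrite inE xyz /dimsum /= E.
have rx := reduced_gact (prop x) (andP rs).1.
have ry := reduced_gact (prop y) (andP rx).1.
have rz := reduced_gact (prop z) (andP ry).1.
by rewrite -[LHS](run_large rz lgt) !run_cancel.
Qed.

(** The group acts on the reduced words: each defining relation acts
    trivially. *)
Lemma eqv_run w w' : eqv w w' -> forall s, reduced s -> run s w = run s w'.
Proof.
elim=> {w w'} [w|w w' _ IH|w1 w2 w3 _ IH1 _ IH2|w1 w2 w1' w2' _ IH1 _ IH2|x b|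
               w w' rel] s rs //.
- by rewrite IH.
- by rewrite IH1 ?IH2.
- by rewrite /run !foldl_cat -!/(run _ _) IH1 // IH2 // reduced_run.
- case: b => /=; last exact: run_cancel.
  by rewrite /letter /= -{2}[x]lambdaK run_cancel.
- case: rel => [x|x y z xyz] //=; exact: run_triangle.
Qed.

Definition positive u : seq (geometry V * bool) := [seq (x, false) | x <- u].

Lemma teval_pi u :
  teval u = \pi_(presented (triangle_rel lambda T)) (positive u).
Proof.
elim: u => [|x u IHu]; first by rewrite /Defs.teval big_nil.
rewrite /Defs.teval big_cons -/(teval u) IHu; exact: pmul_pi.
Qed.

Lemma normal_stringE u : normal_string lambda u = reduced (map prop (rev u)).
Proof.
rewrite /reduced all_map (eq_all (a2 := predT)) ?all_predT ?andbT //.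
rewrite map_rev /normal rev_sorted sorted_map /normal_string.
by apply: eq_sorted => x y; rewrite (join_normal hn hV hl hT).
Qed.

Lemma run_normal u : normal_string lambda u ->
  run [::] (positive u) = map prop (rev u).
Proof.
rewrite normal_stringE; elim/last_ind: u => //= u x IHu.
rewrite /positive map_rcons rev_rcons /= => rux.
rewrite /run foldl_rcons -/(run _ _) IHu; first exact: (gact_reduced rux).
by case/andP: rux => /path_sorted nu /andP[_ pu]; apply/andP.
Qed.

(** Reduced words are recovered from the group elements that they represent,
    by the action on the empty word. *)
Lemma teval_gact u v x : normal_string lambda u -> normal_string lambda v ->
  teval v = teval u * tgen x ->
  map prop (rev v) = gact (map prop (rev u)) (prop x).
Proof.
move=> nu nv; rewrite !teval_pi [RHS]pmul_pi => /pi_presentedP E.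
rewrite -(run_normal nv) (eqv_run E) // /run foldl_cat -!/(run _ _).
by rewrite run_normal.
Qed.

Lemma teval_inj u v : normal_string lambda u -> normal_string lambda v ->
  teval u = teval v -> u = v.
Proof.
move=> nu nv; rewrite !teval_pi => /pi_presentedP E.
apply: (can_inj revK); apply: (inj_map prop_inj).
by rewrite -!run_normal // (eqv_run E).
Qed.

Lemma reduced_map (s : seq S) : all (@proper_letter S) s ->
  exists u, s = map prop u.
Proof.
elim: s => [|[||x] s IHs] //=; first by exists [::].
by move/IHs => [u ->]; exists (x :: u).
Qed.

Lemma wval_map u : wval sgen (map prop u) = teval u.
Proof. by rewrite /wval big_map. Qed.

Lemma wval_run w : wval sgen (rev (run [::] w)) =
  \pi_(presented (triangle_rel lambda T)) w.
Proof.
elim/last_ind: w => [|w [x b] IHw]; first by rewrite /wval big_nil.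
rewrite /run foldl_rcons -/(run _ _) (wval_gact sgenM) // IHw -cats1.
rewrite -[RHS]pmul_pi; congr (_ * _); case: b => //.
exact/pi_presentedP/eqv_rel/rel_lambda.
Qed.

Lemma normal_form_ex (g : Gamma) :
  exists2 u, normal_string lambda u & teval u = g.
Proof.
have rr : reduced (run [::] (repr g)) by exact: reduced_run.
have /andP[_ /reduced_map[u E]] := rr.
exists (rev u); first by rewrite normal_stringE revK -E.
by rewrite -wval_map map_rev -E wval_run reprK.
Qed.

Lemma tprefix_simple u v x t :
  normal_string lambda u -> normal_string lambda v ->
  teval v = teval u * tgen x ->
  exists s, tprefix lambda T v t = tprefix lambda T u t * sgen s.
Proof.
move=> nu nv E; have ru := nu; rewrite normal_stringE in ru.
have sgen_top : sgen (gcompl (gone S)) = 1 by [].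
have [s] := fellow_traveller sgenM sgen_top (prop x) t ru.
rewrite -(teval_gact nu nv E) -!map_rev !revK -!map_take !wval_map.
by exists s.
Qed.

End TriangleNormalForm.

Theorem theorem2 (V : proj_space) (n : nat) (hn : 2 <= n) (hV : pdim V = n)
    (lambda : geometry V -> geometry V) (hl : polar_involution n lambda)
    (T : {set geometry V * geometry V * geometry V})
    (hT : triangle_presentation n lambda T) :
  (forall (u v : seq (geometry V)) (x : geometry V),
     normal_string lambda u -> normal_string lambda v ->
     teval lambda T v = teval lambda T u * tgen lambda T x ->
     forall t : nat,
       tdist (tprefix lambda T u t) (tprefix lambda T v t) <= 1 /\
       (tprefix lambda T u t = tprefix lambda T v t \/
        exists xt : geometry V,
          tprefix lambda T u t = tprefix lambda T v t * tgen lambda T xt)) /\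
  automatic (Gamma lambda T).
Proof.
split.
  move=> u v x nu nv E t.
  have [s Es] := tprefix_simple hn hV hl hT t nu nv E; split.
    rewrite /tdist /word_dist Es mulKg; case: s {Es} => [||y].
    + exact: leq_trans (word_length_le _ [::]) _.
    + exact: leq_trans (word_length_le _ [::]) _.
    + exact: word_length_le _ [:: (y, false)].
  case: s Es => [||y] /= ->; rewrite ?mulg1; [by left|by left|].
  by right; exists (lambda y); rewrite tgenV mulgK.
pose g (o : option (geometry V)) := if o is Some x then tgen lambda T x else 1.
pose r := fun u v => join_is_V (lambda u) v.
have fellow h :
    (forall u v, normal_string lambda u -> normal_string lambda v ->
       teval lambda T u * h = teval lambda T v ->
       forall t, exists o,
         (tprefix lambda T u t)^-1 * tprefix lambda T v t = g o) ->
    regular_rel (fun u v => [/\ normal_string lambda u,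
      normal_string lambda v & teval lambda T u * h = teval lambda T v]).
  exact: (@regular_fellow _ _ _ _ g None _ r).
exists (geometry V), (tgen lambda T), (normal_string lambda); split => //.
- by apply: regular_ext (regular_local predT r) => u; rewrite all_predT.
- exact: normal_form_ex hn hV hl hT.
- have H u v (nu : normal_string lambda u) (nv : normal_string lambda v) :
      teval lambda T u * 1 = teval lambda T v ->
      forall t, exists o,
        (tprefix lambda T u t)^-1 * tprefix lambda T v t = g o.
    move=> E t; exists None; rewrite mulg1 in E.
    by rewrite (teval_inj hn hV hl hT nu nv E) mulVg.
  apply: regular_ext (fellow 1 H) => p.
  split=> -[u [v [[nu nv E] ->]]]; exists u, v; first by rewrite mulg1 in E.
  by rewrite /teval mulg1.
- move=> x; apply: fellow => u v nu nv /esym E t.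
  have [s ->] := tprefix_simple hn hV hl hT t nu nv E.
  by rewrite mulKg; case: s => [||y]; [exists None|exists None|exists (Some y)].
Qed.
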